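(* In the $k$-dimensional DRB game, there is no non-uniform Nash equilibrium for sufficiently large $n$, i.e. no strategy profile $\mathbf r$ in which not all $r_u$ are equal is a Nash equilibrium.
   Context: DRB (Distance-Reciprocity Balanced) game. Fix an integer $k\ge 1$ and $\gamma=1/g$ with $g\ge 2$ an integer. For an integer $n\ge 2$ let $V=\{1,\dots,n\}^k$, viewed as a torus grid with distance $d_M(u,v)=\sum_{i=1}^k\min\{|u_i-v_i|,\,n-|u_i-v_i|\}$. Each node $u\in V$ is a player with strategy $r_u\in\Sigma=\{0,\gamma,2\gamma,3\gamma,\dots\}$ and a constant exponent $\alpha_u>0$ (possibly different for different nodes). For $r\ge 0$ let $c(r)=\sum_{v\ne u}d_M(u,v)^{-r}$ (independent of $u$) and $p_u(v,r)=d_M(u,v)^{-r}/c(r)$ for $v\neq u$. The payoff of $u$ under the strategy profile $\mathbf r=(r_v)_{v\in V}$ is $$\pi_u(r_u,\mathbf r_{-u})=\Big(\sum_{v\ne u}p_u(v,r_u)\,d_M(u,v)\Big)^{\alpha_u}\Big(\sum_{v\ne u}p_u(v,r_u)\,p_v(u,r_v)\Big).$$ A strategy $r_u^*\in\Sigma$ is a best response to $\mathbf r_{-u}$ if $\pi_u(r_u^*,\mathbf r_{-u})\ge\pi_u(r_u,\mathbf r_{-u})$ for all $r_u\in\Sigma$. A Nash equilibrium is a profile in which each $r_u$ is a best response to $\mathbf r_{-u}$. A statement being true ''for sufficiently large $n$'' means that there exists a constant $n_0\in\mathbb N$, which may only depend on model constants such as $k$, $\gamma$ and $\alpha_u$,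 such that for all $n\ge n_0$ the statement is true in the grid with parameter $n$.
   Formalization: The exponents α_u are assumed to lie in a fixed range [a,b] with a>0, and n_0 depends only on k, γ, a and b; if the α_u may vary with n without such bounds, non-uniform equilibria exist. *)

(* Defs.v *)
From mathcomp Require Import all_boot all_order all_algebra.
From mathcomp Require Import all_classical all_reals all_analysis.

Set Implicit Arguments.
Unset Strict Implicit.
Unset Printing Implicit Defensive.

Import Order.TTheory GRing.Theory Num.Theory.

Local Open Scope classical_set_scope.
Local Open Scope ring_scope.

(* Coordinates range over 0, ..., n - 1 instead of 1, ..., n; only differences
   of coordinates are ever used. *)
Notation node k n := {ffun 'I_k -> 'I_n}.

Definition dist (k n : nat) (u v : node k n) : nat :=
  (\sum_(i < k) minn `|(u i : nat) - (v i : nat)|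
                     (n - `|(u i : nat) - (v i : nat)|))%N.

(* On the torus this does not depend on [u]. *)
Definition norm_const (R : realType) (k n : nat) (u : node k n) (r : R) : R :=
  \sum_(v : node k n | v != u) (dist u v)%:R `^ (- r).

Definition link_prob (R : realType) (k n : nat) (u v : node k n) (r : R) : R :=
  (dist u v)%:R `^ (- r) / norm_const u r.

(* [payoff alpha s u r] is the payoff of [u] when it plays [r] and every other
   node [v] plays [s v]; the value [s u] is not used. *)
Definition payoff (R : realType) (k n : nat) (alpha s : node k n -> R)
    (u : node k n) (r : R) : R :=
  (\sum_(v : node k n | v != u) link_prob u v r * (dist u v)%:R) `^ alpha u *
  (\sum_(v : node k n | v != u) link_prob u v r * link_prob v u (s v)).

Definition strategies (R : realType) (gamma : R) : set R :=
  [set m%:R * gamma | m in [set: nat]].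

Definition best_response (R : realType) (k n : nat) (gamma : R)
    (alpha s : node k n -> R) (u : node k n) (r : R) : Prop :=
  strategies gamma r /\
  forall r', strategies gamma r' -> payoff alpha s u r' <= payoff alpha s u r.

Definition Nash_equilibrium (R : realType) (k n : nat) (gamma : R)
    (alpha s : node k n -> R) : Prop :=
  forall u, best_response gamma alpha s u (s u).

Definition non_uniform (R : realType) (k n : nat) (s : node k n -> R) : Prop :=
  exists u v, s u <> s v.

(* Main.v *)
Require Import Defs.
From mathcomp Require Import all_boot all_order all_algebra.
From mathcomp Require Import all_classical all_reals all_analysis.
From mathcomp Require Import zify ring lra.

Import Order.TTheory GRing.Theory Num.Theory.
Local Open Scope ring_scope.

(* Up to powers of log n, which are absorbed by n^gamma, everything is a
   comparison of exponents of n.  A strategy r > k shortens the mean distance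
   from about n to at most n^(1 - gamma) without increasing the unnormalized
   reciprocity, so it loses against k and every node plays at most k.  Let
   m >= gamma be the largest strategy, played by w, and let u be adjacent to w.
   Playing k, u gets reciprocity about n^(m - k) from w alone; playing
   r <= k - gamma it gets at most about n^(m - k - gamma), because any v at
   distance d links to u with probability at most about n^(m - k) d^(-m).
   Hence u plays k, so m = k; the same comparison then spreads k from each node
   to its neighbours, and since the torus is connected the profile is uniform. *)

(** * Distances on the torus and its connectedness *)

Lemma distC (k n : nat) (u v : node k n) : dist u v = dist v u.
Proof. by apply: eq_bigr => i _; rewrite distnC. Qed.

Lemma dist_le (k n : nat) (u v : node k n) : (dist u v <= k * n)%N.
Proof.
rewrite -[k in (k * n)%N]card_ord -sum_nat_const; apply: leq_sum => i _.
by rewrite geq_min leq_subr orbT.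
Qed.

Lemma dist_gt0 (k n : nat) (u v : node k n) : v != u -> (0 < dist u v)%N.
Proof.
move=> nvu; have [i nvui] : exists i, v i != u i.
  apply/existsP; apply: contraR nvu => /existsPn h.
  by apply/eqP/ffunP => i; apply/eqP; rewrite -[_ == _]negbK; apply: h.
rewrite /dist (bigD1 i) //= ltn_addr //.
have := ltn_ord (u i); have := ltn_ord (v i).
have : (v i : nat) <> u i by move/val_inj/eqP; apply/negP.
lia.
Qed.

Definition setc (k n : nat) (u : node k n) (i : 'I_k) (x : 'I_n) : node k n :=
  [ffun j => if j == i then x else u j].

Lemma dist_setc_ordS (k n : nat) (u : node k n) (i : 'I_k) : (2 <= n)%N ->
  dist u (setc k n u i (ordS (u i))) = 1%N.
Proof.
move=> n2; rewrite /dist (bigD1 i) //= big1 => [|j ji]; last first.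
  by rewrite ffunE (negPf ji) distnn min0n.
rewrite ffunE eqxx /= addn0; have := ltn_ord (u i).
(* If [u i] is the last index, [ordS] wraps to 0; the coordinates then differ by [n - 1], and the
   second argument of [minn] gives 1. *)
rewrite leq_eqVlt => /orP[/eqP e|lt]; last by rewrite modn_small //; lia.
by rewrite e modnn; lia.
Qed.

(** Connectedness as an induction principle: [w] is turned into any node one coordinate after
    another, each by unit steps along its cycle. *)
Lemma torus_ind (k n : nat) (P : node k n -> Prop) (w : node k n) :
  (2 <= n)%N -> P w -> (forall u v, P u -> dist u v = 1%N -> P v) ->
  forall v, P v.
Proof.
move=> n2 Pw step.
have setP i t : forall u, P u -> P (setc k n u i (iter t (@ordS n) (u i))).
  elim: t => [u Pu|t IH u Pu] /=.
    by have -> // : setc k n u i (u i) = u by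
      apply/ffunP => j; rewrite ffunE; case: eqP => [->|].
  pose v := setc k n u i (iter t (@ordS n) (u i)).
  have vi : v i = iter t (@ordS n) (u i) by rewrite ffunE eqxx.
  have -> : setc k n u i (ordS (iter t (@ordS n) (u i))) =
            setc k n v i (ordS (v i)).
    by apply/ffunP => j; rewrite !ffunE eqxx; case: eqP.
  by apply: step (dist_setc_ordS _ _ _ _ n2); apply: IH.
have iterS t (x : 'I_n) : (iter t (@ordS n) x : nat) = ((x + t) %% n)%N.
  elim: t => [|t /= ->]; first by rewrite addn0 modn_small.
  by rewrite addnS -[in LHS]addn1 modnDml addn1.
have setP' u i x : P u -> P (setc k n u i x).
  (* [n - u i] steps lead around the cycle to 0 and [x] more reach [x], so forward steps suffice. *)
  move=> Pu; have -> : x = iter (n - u i + x) (@ordS n) (u i).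
    apply: ord_inj; rewrite iterS addnA subnKC ?(ltnW (ltn_ord _)) //.
    by rewrite modnDl modn_small.
  exact: setP.
move=> v.
(* Intermediate nodes agree with [v] on the first [t] coordinates and with [w] on the others. *)
have H t : (t <= k)%N -> P [ffun i : 'I_k => if (i < t)%N then v i else w i].
  elim: t => [_|t IH tk].
    by have -> // : [ffun i : 'I_k => if (i < 0)%N then v i else w i] = w
      by apply/ffunP => i; rewrite ffunE.
  have := setP' _ (Ordinal tk) (v (Ordinal tk)) (IH (ltnW tk)).
  congr P; apply/ffunP => j; rewrite !ffunE ltnS (leq_eqVlt j t) -val_eqE /=.
  by case: eqP => //= jt; congr (v _); apply: ord_inj.
have -> : v = [ffun i : 'I_k => if (i < k)%N then v i else w i].
  by apply/ffunP => i; rewrite ffunE ltn_ord.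
exact: H.
Qed.

(** * Harmonic sums, and logarithms against powers of [n] *)

(** The induction step is [1/(n+2) <= ln (n+2) - ln (n+1)], which is [ln (1 + x) <= x] at
    [x = -1/(n+2)]. The case [n = 0] relies on the default [ln 0 = 0]. *)
Lemma harmonic_le (R : realType) (n : nat) :
  \sum_(0 <= j < n) (j.+1%:R)^-1 <= 1 + ln n%:R :> R.
Proof.
case: n => [|n]; first by rewrite big_nil ln0 // addr0.
elim: n => [|n IH]; first by rewrite big_nat1 ln1 addr0 invr1.
rewrite big_nat_recr //=; apply: (le_trans (lerD IH (lexx _))).
rewrite -addrA lerD2l.
have n1 : 0 < n.+1%:R :> R by rewrite ltr0n.
have n2 : 0 < n.+2%:R :> R by rewrite ltr0n.
have e : n.+1%:R = (1 + - (n.+2%:R)^-1) * n.+2%:R :> R.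
  by rewrite mulrBl mul1r mulVf ?gt_eqF // -(natr1 n.+1) addrK.
have p : 0 < 1 + - (n.+2%:R)^-1 :> R by rewrite -(pmulr_lgt0 _ n2) -e.
rewrite {1}e lnM ?posrE // addrAC gerDr.
have := @le_ln1Dx R (- (n.+2%:R)^-1).
move: p; set y : R := n.+2%:R^-1 => p.
have h : -1 < - y by lra.
by move=> /(_ h); lra.
Qed.

(** Split at [i]: on either side the differences are distinct and below [n], so each part is at most
    the full sum of [f]. *)
Lemma sum_distn_le (R : realType) (n : nat) (i : 'I_n) (f : nat -> R) :
  (forall j, 0 <= f j) ->
  \sum_(j < n) f `|(i : nat) - (j : nat)|%N <= 2 * \sum_(0 <= j < n) f j.
Proof.
move=> f0; have hi := ltn_ord i.
rewrite -(big_mkord xpredT (fun j => f `|(i : nat) - j|%N)).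
rewrite (@big_cat_nat _ _ _ i.+1) //= mulr2n mulrDl !mul1r.
apply: lerD.
  rewrite big_nat_rev /= (eq_big_nat _ _ (F2 := f)); last first.
    by move=> j /andP[_ hj]; congr f; lia.
  rewrite [leRHS](@big_cat_nat _ _ _ i.+1) //= lerDl.
  exact: sumr_ge0.
rewrite -{1}[i.+1]add0n big_addn.
rewrite (eq_big_nat _ _ (F2 := f \o succn)); last first.
  by move=> j /andP[_ hj] /=; congr f; lia.
rewrite -(big_add1 _ _ 0 (n - i.+1).+1 xpredT f).
rewrite [leRHS](@big_cat_nat _ _ _ (n - i.+1).+1) //=; last by lia.
rewrite -[leLHS]addr0; apply: lerD; last exact: sumr_ge0.
by rewrite [leRHS]big_nat_recl // -(big_add1 _ _ 0 (n - i.+1).+1 xpredT f) lerDr.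
Qed.

Lemma circle_sum_le (R : realType) (n : nat) (i : 'I_n) :
  \sum_(j < n) ((maxn 1 (minn `|(i : nat) - (j : nat)|
     (n - `|(i : nat) - (j : nat)|)))%:R)^-1 <= 6 * (1 + ln n%:R) :> R.
Proof.
pose f t : R := ((maxn 1 (minn t (n - t)))%:R)^-1.
apply: (le_trans (@sum_distn_le R n i f _)) => [j|]; first by rewrite invr_ge0.
have n1 : (0 < n)%N by case: (n) i => // -[].
have lnn : 0 <= ln n%:R :> R by rewrite ln_ge0 // ler1n.
(* The reciprocal of a minimum is at most the sum of the two reciprocals. The two sums are bounded
   by [2 + ln n] and [1 + ln n]; doubling gives [6 + 4 ln n]. *)
have h : \sum_(0 <= j < n) f j <= \sum_(0 <= j < n) ((maxn 1 j)%:R)^-1 +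
     \sum_(0 <= j < n) (n - j)%:R^-1.
  rewrite -big_split /=; apply: ler_sum_nat => j /andP[_ jn].
  rewrite /f; case: (leqP j (n - j)) => hj.
    by rewrite lerDl invr_ge0.
  by rewrite (maxn_idPr _) ?lerDr ?invr_ge0 //; lia.
have h2 : \sum_(0 <= j < n) (n - j)%:R^-1 <= 1 + ln n%:R :> R.
  rewrite big_nat_rev /=; apply: le_trans (harmonic_le R n).
  apply: ler_sum_nat => j /andP[_ jn].
  by have -> : (n - (0 + n - j.+1))%N = j.+1 by lia.
have h1 : \sum_(0 <= j < n) ((maxn 1 j)%:R)^-1 <= 1 + (1 + ln n%:R) :> R.
  rewrite -(prednK n1) big_nat_recl //= invr1 lerD2l.
  rewrite (eq_bigr (fun j => j.+1%:R^-1)) => [|j _]; last first.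
    by rewrite (maxn_idPr _).
  apply: le_trans (harmonic_le R n.-1) _; rewrite lerD2l.
  case: (n) n1 => [//|[_|m _]] /=; first by rewrite ln0 // ln1.
  by rewrite ler_ln ?posrE ?ltr0n // ler_nat.
lra.
Qed.

(** With [x = ln n], [n^c] is the power [q + 1] of [exp (c x / (q+1))], which is at least
    [e (1 + x)]. The surplus factor [1 + x] beats the constant [M] as soon as [ln n > M]. *)
Lemma polylog_lt_powR (R : realType) (C c : R) (q : nat) : 0 <= C -> 0 < c ->
  exists n0 : nat, forall n, (n0 <= n)%N ->
    (C * (1 + ln n%:R)) ^+ q < n%:R `^ c.
Proof.
move=> C0 c0.
pose e : R := Num.min 1 (c / q.+1%:R).
have e0 : 0 < e by rewrite lt_min ltr01 divr_gt0.
pose M : R := C ^+ q / e ^+ q.+1.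
have M0 : 0 <= M by rewrite divr_ge0 ?exprn_ge0 // ltW.
exists (Num.truncn (expR M)).+1 => n hn.
have hM : expR M < n%:R.
  by apply: lt_le_trans (truncnS_gt _) _; rewrite ler_nat.
have n0 : 0 < n%:R :> R by apply: lt_trans hM; apply: expR_gt0.
set x := ln n%:R.
have Mx : M < x by rewrite -ltr_expR lnK.
have x0 : 0 <= x by lra.
have -> : n%:R `^ c = expR (c * x / q.+1%:R) ^+ q.+1.
  rewrite -expRM_natl mulrC divfK ?pnatr_eq0 //.
  by rewrite -(lnK (x := n%:R `^ c)) ?posrE ?powR_gt0 // ln_powR.
apply: (@lt_le_trans _ _ ((e * (1 + x)) ^+ q.+1)).
  rewrite !exprMn [X in _ < _ * X]exprS mulrA ltr_pM2r ?exprn_gt0 //; last lra.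
  rewrite -ltr_pdivrMl ?exprn_gt0 // mulrC -/M; lra.
rewrite lerXn2r ?nnegrE ?expR_ge0 //; first by rewrite mulr_ge0 ?ltW //; lra.
apply: le_trans (expR_ge1Dx _); rewrite mulrDr mulr1 lerD //.
  by rewrite /e ge_min lexx.
rewrite [leRHS]mulrAC ler_wpM2r // /e ge_min lexx orbT //.
Qed.

(** * Bounds on the normalizing constant *)

Lemma exists_neighbor (k n : nat) (u : node k n) :
  (1 <= k)%N -> (2 <= n)%N -> exists v, dist u v = 1%N.
Proof.
move=> k1 n2; exists (setc k n u (Ordinal k1) (ordS (u (Ordinal k1)))).
exact: dist_setc_ordS.
Qed.

Lemma dist_neq (k n : nat) (u v : node k n) : (0 < dist u v)%N -> v != u.
Proof.
apply: contraTneq => ->; rewrite -eqn0Ngt /dist sum_nat_eq0.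
by apply/forallP => i; rewrite distnn min0n.
Qed.

(* As d^k >= \prod_i max(1, d_i), the sum is bounded by a product of
   one-dimensional harmonic sums. *)
Lemma norm_const_dim_le (R : realType) (k n : nat) (u : node k n) :
  norm_const u (k%:R : R) <= (6 * (1 + ln n%:R)) ^+ k.
Proof.
pose t i j : nat := minn `|(u i : nat) - (j : nat)|
                     (n - `|(u i : nat) - (j : nat)|).
(* [maxn 1] handles coordinates on which [u] and [v] agree: the default inverse of 0 is 0 and would
   annihilate the product. *)
pose F (i : 'I_k) (j : 'I_n) : R := ((maxn 1 (t i j))%:R)^-1.
have F0 i j : 0 <= F i j by rewrite invr_ge0.
(* Admitting [v = u] makes the sum range over all functions, so that it factors by coordinates. *)
apply: (@le_trans _ _ (\sum_(v : node k n) \prod_i F i (v i))).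
  rewrite /norm_const [leRHS](bigD1 u) //=.
  apply: (@le_trans _ _ (\sum_(v : node k n | v != u) \prod_i F i (v i))).
    2: by rewrite lerDr prodr_ge0.
  apply: ler_sum => v vu; have d0 := dist_gt0 _ _ _ _ vu.
  rewrite powRN powR_mulrn // prodfV lef_pV2 ?posrE ?exprn_gt0 ?ltr0n //; last first.
    by apply: prodr_gt0 => i _; rewrite ltr0n leq_max.
  have -> : (dist u v)%:R ^+ k = \prod_(i < k) (dist u v)%:R :> R.
    by rewrite prodr_const card_ord.
  apply: ler_prod => i _.
  rewrite ler0n ler_nat geq_max d0 /=.
  by rewrite /dist (bigD1 i) //= leq_addr.
rewrite -(bigA_distr_bigA F).
have -> : (6 * (1 + ln n%:R)) ^+ k = \prod_(i < k) (6 * (1 + ln n%:R)) :> R.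
  by rewrite prodr_const card_ord.
apply: ler_prod => i _; rewrite sumr_ge0 //=.
exact: circle_sum_le.
Qed.

Lemma norm_const_ge1 (R : realType) (k n : nat) (u : node k n) (r : R) :
  (1 <= k)%N -> (2 <= n)%N -> 1 <= norm_const u r.
Proof.
move=> k1 n2; have [v uv] := exists_neighbor _ _ u k1 n2.
have vu : v != u by apply: dist_neq; rewrite uv.
rewrite /norm_const (bigD1 v) //= uv powR1 lerDl.
by apply: sumr_ge0 => w _; exact: powR_ge0.
Qed.

(** Since [1 <= d <= k n], one has [d^(x-y) <= d^z <= (k n)^z]. This trades one exponent of the
    distance for another at the price of a power of [k n]. *)
Lemma dist_powR_le (R : realType) (k n : nat) (u v : node k n) (x y z : R) :
  v != u -> x - y <= z -> 0 <= z ->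
  (dist u v)%:R `^ x <= (k * n)%:R `^ z * (dist u v)%:R `^ y.
Proof.
move=> vu xyz z0; have d0 := dist_gt0 _ _ _ _ vu.
rewrite -{1}(subrK y x) powRD; last by rewrite pnatr_eq0 -lt0n d0 implybT.
rewrite ler_wpM2r ?powR_ge0 //.
apply: (@le_trans _ _ ((dist u v)%:R `^ z)).
  by apply: ler_powR; rewrite // ler1n.
by apply: ge0_ler_powR; rewrite ?nnegrE // ler_nat dist_le.
Qed.

(** Comparison with the critical exponent [-k], at which the sum is only polylogarithmic. *)
Lemma sum_powR_dist_le (R : realType) (k n : nat) (u : node k n) (x z : R) :
  x + k%:R <= z -> 0 <= z ->
  \sum_(v : node k n | v != u) (dist u v)%:R `^ x
    <= (k * n)%:R `^ z * norm_const u k%:R.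
Proof.
move=> xz z0; rewrite /norm_const mulr_sumr; apply: ler_sum => v vu.
by apply: dist_powR_le => //; rewrite opprK.
Qed.

Lemma sum_nodes_ge (R : realType) (k n : nat) (u : node k n)
    (f : node k n -> R) (c : R) : (1 <= k)%N -> (2 <= n)%N -> 0 <= c ->
  (forall v, v != u -> c <= f v) ->
  n%:R ^+ k / 2 * c <= \sum_(v : node k n | v != u) f v.
Proof.
move=> k1 n2 c0 cf.
apply: (@le_trans _ _ (\sum_(v : node k n | v != u) c)); last exact: ler_sum.
rewrite sumr_const -[c *+ _]mulr_natl ler_wpM2r //.
(* There are [n^k - 1] other nodes, at least [n^k / 2] because [n^k >= 2]. *)
rewrite cardC1 card_ffun !card_ord -natrX.
have h : (2 <= n ^ k)%N.
  by apply: (leq_trans n2); rewrite -{1}[n]expn1 leq_exp2l.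
rewrite ler_pdivrMr // -natrM ler_nat; lia.
Qed.

Lemma norm_const_ge (R : realType) (k n : nat) (u : node k n) (r : R) :
  (1 <= k)%N -> (2 <= n)%N -> 0 <= r ->
  n%:R ^+ k / 2 * (k * n)%:R `^ (- r) <= norm_const u r.
Proof.
move=> k1 n2 r0; apply: sum_nodes_ge; rewrite ?powR_ge0 // => v vu.
have d0 := dist_gt0 _ _ _ _ vu.
rewrite !powRN lef_pV2 ?posrE ?powR_gt0 ?ltr0n ?muln_gt0 ?k1 ?(ltnW n2) //.
by apply: ge0_ler_powR; rewrite ?nnegrE // ler_nat dist_le.
Qed.

(** * Link probabilities and mean link distance *)

Lemma link_prob_ge0 (R : realType) (k n : nat) (u v : node k n) (r : R) :
  0 <= link_prob u v r.
Proof. by rewrite divr_ge0 ?powR_ge0 ?sumr_ge0 // => w _; exact: powR_ge0. Qed.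

(** Inverts [norm_const_ge]; the constant [2 k^k] comes from [n^k / 2 = (k n)^k / (2 k^k)]. *)
Lemma link_prob_le (R : realType) (k n : nat) (u v : node k n) (r : R) :
  (1 <= k)%N -> (2 <= n)%N -> 0 <= r ->
  link_prob u v r <=
  2 * k%:R ^+ k * (k * n)%:R `^ (r - k%:R) * (dist u v)%:R `^ (- r).
Proof.
move=> k1 n2 r0; rewrite /link_prob mulrC ler_wpM2r ?powR_ge0 //.
have X0 : 0 < (k * n)%:R :> R by rewrite ltr0n muln_gt0 k1 ltnW.
have c0 : 0 < n%:R ^+ k / 2 * (k * n)%:R `^ (- r) :> R.
  by rewrite mulr_gt0 ?powR_gt0 // divr_gt0 // exprn_gt0 // ltr0n ltnW.
apply: (@le_trans _ _ (n%:R ^+ k / 2 * (k * n)%:R `^ (- r))^-1).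
  rewrite lef_pV2 ?posrE //; first exact: norm_const_ge.
  exact: lt_le_trans c0 (norm_const_ge _ _ _ _ _ k1 n2 r0).
rewrite powRD ?(gt_eqF X0) ?implybT // !powRN (powR_mulrn _ (ltW X0)).
rewrite natrM exprMn -natrM !invfM !invrK.
have e1 : k%:R ^+ k != 0 :> R by rewrite expf_neq0 // pnatr_eq0 -lt0n.
have e2 : n%:R ^+ k != 0 :> R by rewrite expf_neq0 // pnatr_eq0 -lt0n ltnW.
by rewrite le_eqVlt; apply/orP; left; apply/eqP; field; rewrite e1 e2.
Qed.

Lemma mean_dist_le (R : realType) (k n : nat) (u : node k n) (r : R) :
  (1 <= k)%N -> (2 <= n)%N ->
  \sum_(v : node k n | v != u) link_prob u v r * (dist u v)%:R <= (k * n)%:R.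
Proof.
move=> k1 n2.
have c0 : 0 < norm_const u r := lt_le_trans ltr01 (norm_const_ge1 R k n u r k1 n2).
apply: (@le_trans _ _ (\sum_(v | v != u) link_prob u v r * (k * n)%:R)).
  apply: ler_sum => v vu; apply: ler_wpM2l; first exact: link_prob_ge0.
  by rewrite ler_nat dist_le.
by rewrite -mulr_suml -mulr_suml -/(norm_const u r) divff ?mul1r ?gt_eqF.
Qed.

Lemma mean_distE (R : realType) (k n : nat) (u : node k n) (r : R) :
  \sum_(v : node k n | v != u) link_prob u v r * (dist u v)%:R =
  (\sum_(v : node k n | v != u) (dist u v)%:R `^ (1 - r)) / norm_const u r.
Proof.
rewrite mulr_suml; apply: eq_bigr => v vu.
have d0 := dist_gt0 _ _ _ _ vu.
rewrite powRD; last by rewrite pnatr_eq0 -lt0n d0 implybT.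
by rewrite powRr1 // /link_prob; ring.
Qed.

(** The normalizer is at least 1 and may be dropped; the remaining exponent [1 - r] exceeds [-k] by
    at most [1 - c]. *)
Lemma mean_dist_le_gt (R : realType) (k n : nat) (u : node k n) (c r : R) :
  (1 <= k)%N -> (2 <= n)%N -> c <= 1 -> k%:R + c <= r ->
  \sum_(v : node k n | v != u) link_prob u v r * (dist u v)%:R <=
  (k * n)%:R `^ (1 - c) * norm_const u k%:R.
Proof.
move=> k1 n2 c1 kr; rewrite mean_distE.
apply: (@le_trans _ _ (\sum_(v : node k n | v != u) (dist u v)%:R `^ (1 - r))).
  have c1' := norm_const_ge1 R k n u r k1 n2.
  rewrite ler_pdivrMr ?(lt_le_trans ltr01) // ler_peMr //.
  by apply: sumr_ge0 => v _; exact: powR_ge0.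
by apply: sum_powR_dist_le; lra.
Qed.

(** As [1 - k <= 0], each of the at least [n^k / 2] terms is at least [(k n)^(1-k)]. At exponent [k]
    the mean distance is thus of order [k n] up to logarithms. *)
Lemma mean_dist_dim_ge (R : realType) (k n : nat) (u : node k n) :
  (1 <= k)%N -> (2 <= n)%N ->
  (k * n)%:R / (2 * k%:R ^+ k * norm_const u k%:R) <=
  \sum_(v : node k n | v != u) link_prob u v (k%:R : R) * (dist u v)%:R.
Proof.
move=> k1 n2; rewrite mean_distE invfM mulrA.
have c1' := norm_const_ge1 R k n u k%:R k1 n2.
have X0 : 0 < (k * n)%:R :> R by rewrite ltr0n muln_gt0 k1 ltnW.
rewrite ler_wpM2r ?invr_ge0 ?(le_trans ler01) //.
apply: (@le_trans _ _ (n%:R ^+ k / 2 * (k * n)%:R `^ (1 - k%:R))).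
  rewrite powRD ?(gt_eqF X0) ?implybT // powRr1 ?(ltW X0) // powRN.
  rewrite (powR_mulrn _ (ltW X0)) (natrM _ k n) exprMn -natrM.
  have e1 : k%:R ^+ k != 0 :> R by rewrite expf_neq0 // pnatr_eq0 -lt0n.
  have e2 : n%:R ^+ k != 0 :> R by rewrite expf_neq0 // pnatr_eq0 -lt0n ltnW.
  by rewrite le_eqVlt; apply/orP; left; apply/eqP; field; rewrite e1 e2.
apply: sum_nodes_ge; rewrite ?powR_ge0 // => v vu.
have d0 := dist_gt0 _ _ _ _ vu.
rewrite -[1 - _]opprB !powRN lef_pV2 ?posrE ?powR_gt0 ?ltr0n //; last first.
  by rewrite muln_gt0 k1 ltnW.
by apply: ge0_ler_powR; rewrite ?nnegrE ?subr_ge0 ?ler1n // ler_nat dist_le.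
Qed.

(** * Strategy [k] against strategies above and below it *)

(** Moving from [r] to [k] costs at most a factor [N] in reciprocity, while the mean distance grows
    by at least [X^c / (A N^2)], which dominates after raising to [alpha u]. *)
Lemma payoff_lt_above (R : realType) (k n E : nat) (alpha s : node k n -> R)
    (u : node k n) (a c r : R) :
  (1 <= k)%N -> (2 <= n)%N -> 0 < a -> a <= alpha u -> 0 <= c -> c <= 1 ->
  2 + a^-1 <= E%:R ->
  (2 * k%:R ^+ k * norm_const u k%:R) ^+ E < (k * n)%:R `^ c ->
  k%:R + c <= r ->
  payoff alpha s u r < payoff alpha s u k%:R.
Proof.
move=> k1 n2 a0 aal c0 c1 aE; have := mean_dist_dim_ge R k n u k1 n2.
set N := norm_const u k%:R.
set A : R := 2 * k%:R ^+ k; set X : R := (k * n)%:R => mean_ge ANX kr.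
have N1 : 1 <= N by apply: norm_const_ge1.
have N0 : 0 < N by apply: lt_le_trans N1.
have A1 : 1 <= A.
  have : 1 <= k%:R ^+ k :> R by rewrite exprn_ege1 // ler1n.
  rewrite /A; lra.
have A0 : 0 < A by apply: lt_le_trans A1.
clearbody A.
have X0 : 0 < X by rewrite ltr0n muln_gt0 k1 ltnW.
have al0 : 0 < alpha u by apply: lt_le_trans aal.
pose S : R := \sum_(v : node k n | v != u)
  (dist u v)%:R `^ (- k%:R) * link_prob v u (s v).
(* A neighbour links back with positive probability; this keeps the inequality strict when [S] is
   cancelled. *)
have S0 : 0 < S.
  have [v uv] := exists_neighbor _ _ u k1 n2.
  have vu : v != u by apply: dist_neq; rewrite uv.
  rewrite /S (bigD1 v) //= ltr_pwDl //; last first.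
    by apply: sumr_ge0 => w _; rewrite mulr_ge0 ?powR_ge0 ?link_prob_ge0.
  rewrite uv powR1 mul1r /link_prob distC uv powR1 div1r invr_gt0.
  by apply: lt_le_trans (norm_const_ge1 R k n v (s v) k1 n2).
have Pr : \sum_(v | v != u) link_prob u v r * link_prob v u (s v) <= S.
  apply: ler_sum => v vu; apply: ler_wpM2r; first exact: link_prob_ge0.
  rewrite /link_prob; have c1' := norm_const_ge1 R k n u r k1 n2.
  rewrite ler_pdivrMr ?(lt_le_trans ltr01) //.
  apply: (@le_trans _ _ ((dist u v)%:R `^ (- k%:R))).
    by apply: ler_powR; rewrite ?ler1n ?dist_gt0 //; lra.
  by rewrite ler_peMr ?powR_ge0.
have PK : \sum_(v | v != u) link_prob u v k%:R * link_prob v u (s v) = S / N.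
  by rewrite /S mulr_suml; apply: eq_bigr => v _; rewrite mulrAC.
have D0 (x : R) : 0 <= \sum_(v | v != u) link_prob u v x * (dist u v)%:R.
  by apply: sumr_ge0 => v _; rewrite mulr_ge0 ?link_prob_ge0.
have Y0 : 0 <= X `^ (1 - c) * N by rewrite mulr_ge0 ?powR_ge0 // ltW.
rewrite /payoff PK.
apply: (@le_lt_trans _ _ ((X `^ (1 - c) * N) `^ alpha u * S)).
  apply: ler_pM => //; first exact: powR_ge0.
    by apply: sumr_ge0 => v _; rewrite mulr_ge0 ?link_prob_ge0.
  apply: ge0_ler_powR; rewrite ?nnegrE ?D0 ?(ltW al0) //.
  exact: mean_dist_le_gt.
apply: (@lt_le_trans _ _ ((X / (A * N)) `^ alpha u * (S / N))); last first.
  rewrite ler_wpM2r ?divr_ge0 ?(ltW S0) ?(ltW N0) //.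
  apply: ge0_ler_powR; rewrite ?nnegrE ?D0 ?(ltW al0) //.
  by rewrite divr_ge0 ?mulr_ge0 // ltW.
rewrite mulrA ltr_pdivlMr // mulrAC ltr_pM2r //.
(* As [N >= 1] and [alpha u >= a], the lost factor satisfies [N <= (N^(1/a))^(alpha u)], so
   everything sits under one power. What remains is [A N^(2 + 1/a) < X^c]. *)
apply: (@le_lt_trans _ _ ((X `^ (1 - c) * N * N `^ (a^-1)) `^ alpha u)).
  rewrite [leRHS]powRM ?powR_ge0 // ler_wpM2l ?powR_ge0 // -powRrM.
  by rewrite le1r_powR // ler_pdivlMl // mulr1.
have Na0 : 0 < N `^ a^-1 by apply: powR_gt0.
apply: gt0_ltr_powR; rewrite ?nnegrE //.
- by rewrite mulr_ge0 // ltW.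
- by rewrite divr_ge0 ?mulr_ge0 // ltW.
rewrite powRB ?(gt_eqF X0) ?implybT // powRr1 ?(ltW X0) //.
have Xc0 : 0 < X `^ c by apply: powR_gt0.
rewrite ltr_pdivlMr ?(mulr_gt0 A0 N0) // -!mulrA gtr_pMr //.
rewrite ltr_pdivrMl // mulr1; apply: le_lt_trans ANX.
have E1 : (0 < E)%N.
  rewrite -(ltr0n R); apply: lt_le_trans aE.
  by rewrite addr_gt0 ?invr_gt0.
rewrite exprMn -(powR_mulrn E (ltW N0)).
apply: (@le_trans _ _ (A * N `^ (2 + a^-1))).
  rewrite powRD ?(gt_eqF N0) ?implybT // (powR_mulrn 2 (ltW N0)) le_eqVlt.
  by apply/orP; left; apply/eqP; ring.
apply: ler_pM; rewrite ?powR_ge0 ?(ltW A0) //; last exact: ler_powR.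
by rewrite -{1}[A]expr1 ler_weXn2l.
Qed.

(** Strategy [k] has mean distance within a factor [A B] of the maximum [X], while its reciprocity,
    from [w] alone, exceeds that of [r] by [X^c] up to powers of [A] and [B]. *)
Lemma payoff_lt_below (R : realType) (k n E : nat) (alpha s : node k n -> R)
    (u w : node k n) (b c m r B : R) :
  (1 <= k)%N -> (2 <= n)%N -> 0 < alpha u -> alpha u <= b ->
  3 + b <= E%:R -> (forall v : node k n, norm_const v k%:R <= B) ->
  (2 * k%:R ^+ k * B) ^+ E < (k * n)%:R `^ c ->
  c <= m -> m <= k%:R -> (forall v, 0 <= s v <= m) -> s w = m ->
  dist u w = 1%N -> 0 <= r -> r <= k%:R - c ->
  payoff alpha s u r < payoff alpha s u k%:R.
Proof.
move=> k1 n2 al0 alb bE NB.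
have := mean_dist_dim_ge R k n u k1 n2.
have := fun v x => link_prob_le R k n u v x k1 n2.
have := fun v x => link_prob_le R k n v u x k1 n2.
set A : R := 2 * k%:R ^+ k; set X : R := (k * n)%:R.
move=> link_in_le link_out_le mean_ge ABX cm mk sm swm uw r0 rk.
have N1 (v : node k n) : 1 <= norm_const v (k%:R : R) by apply: norm_const_ge1.
have B1 : 1 <= B := le_trans (N1 u) (NB u).
have B0 : 0 < B by apply: lt_le_trans B1.
have A1 : 1 <= A.
  have : 1 <= k%:R ^+ k :> R by rewrite exprn_ege1 // ler1n.
  rewrite /A; lra.
have A0 : 0 < A by apply: lt_le_trans A1.
clearbody A.
have Z1 : 1 <= A * B by apply: le_trans A1 _; rewrite ler_peMr ?(ltW A0).
have Z0 : 0 < A * B by apply: lt_le_trans Z1.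
have X0 : 0 < X by rewrite ltr0n muln_gt0 k1 ltnW.
have XD x y : X `^ (x + y) = X `^ x * X `^ y.
  by rewrite powRD // (gt_eqF X0) implybT.
have D0 (x : R) : 0 <= \sum_(v | v != u) link_prob u v x * (dist u v)%:R.
  by apply: sumr_ge0 => v _; rewrite mulr_ge0 ?link_prob_ge0.
have wu : w != u by apply: dist_neq; rewrite uw.
(* A node playing less than [m] obeys the bound for [m] too, since [d^(m - s v) <= X^(m - s v)]. *)
have link_in v : v != u ->
    link_prob v u (s v) <= A * X `^ (m - k%:R) * (dist u v)%:R `^ (- m).
  move=> vu; have /andP[sv0 svm] := sm v.
  apply: le_trans (link_in_le _ _ sv0) _.
  rewrite -!mulrA ler_wpM2l ?(ltW A0) //.
  have -> : m - k%:R = (s v - k%:R) + (m - s v) by ring.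
  rewrite (XD (s v - _)) -mulrA ler_wpM2l ?powR_ge0 // distC.
  by apply: dist_powR_le => //; lra.
have Pr : \sum_(v | v != u) link_prob u v r * link_prob v u (s v) <=
    A ^+ 2 * B * X `^ (m - k%:R) / X `^ c.
  apply: (@le_trans _ _ (A ^+ 2 * (X `^ (r - k%:R) * X `^ (m - k%:R)) *
      \sum_(v : node k n | v != u) (dist u v)%:R `^ (- (r + m)))).
    rewrite mulr_sumr; apply: ler_sum => v vu; have d0 := dist_gt0 _ _ _ _ vu.
    rewrite opprD (@powRD _ (dist u v)%:R); last by rewrite pnatr_eq0 -lt0n d0 implybT.
    apply: (@le_trans _ _ ((A * X `^ (r - k%:R) * (dist u v)%:R `^ (- r)) *
       (A * X `^ (m - k%:R) * (dist u v)%:R `^ (- m)))).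
      apply: ler_pM; rewrite ?link_prob_ge0 //; last exact: link_in.
      exact: link_out_le.
    by rewrite le_eqVlt; apply/orP; left; apply/eqP; ring.
  (* [c <= m] bounds the exponent and [r <= k - c] makes [k - c - r] nonnegative. *)
  have h : \sum_(v : node k n | v != u) (dist u v)%:R `^ (- (r + m)) <=
      X `^ (k%:R - c - r) * B.
    apply: (@le_trans _ _ (X `^ (k%:R - c - r) * norm_const u k%:R)).
      by apply: sum_powR_dist_le; lra.
    by rewrite ler_wpM2l ?powR_ge0.
  apply: (le_trans (ler_wpM2l _ h)).
    by rewrite !mulr_ge0 ?exprn_ge0 ?powR_ge0 // ltW.
  have e : X `^ (r - k%:R) * X `^ (k%:R - c - r) = (X `^ c)^-1.
    by rewrite -XD -powRN; congr (_ `^ _); ring.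
  by rewrite -e le_eqVlt; apply/orP; left; apply/eqP; ring.
have PK : X `^ (m - k%:R) / B ^+ 2 <=
    \sum_(v | v != u) link_prob u v k%:R * link_prob v u (s v).
  rewrite (bigD1 w) //= swm.
  apply: (@le_trans _ _ (link_prob u w k%:R * link_prob w u m)); last first.
    rewrite lerDl; apply: sumr_ge0 => v _.
    by rewrite mulr_ge0 ?link_prob_ge0.
  rewrite /link_prob (distC _ _ w u) uw !powR1 !div1r -invfM.
  have -> : m - k%:R = - (k%:R - m) by ring.
  have N0 x (v : node k n) : 0 < norm_const v (x : R).
    by apply: lt_le_trans (norm_const_ge1 _ _ _ _ _ k1 n2).
  rewrite powRN -invfM lef_pV2 ?posrE ?mulr_gt0 ?powR_gt0 ?exprn_gt0 //.
  have h : norm_const w m <= X `^ (k%:R - m) * B.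
    apply: (@le_trans _ _ (X `^ (k%:R - m) * norm_const w k%:R)).
      by apply: sum_powR_dist_le; lra.
    by rewrite ler_wpM2l ?powR_ge0.
  apply: (le_trans (ler_pM _ _ (NB u) h)); rewrite ?(ltW (N0 _ _)) //.
  by rewrite le_eqVlt; apply/orP; left; apply/eqP; ring.
rewrite /payoff.
apply: (@le_lt_trans _ _
    (X `^ alpha u * (A ^+ 2 * B * X `^ (m - k%:R) / X `^ c))).
  apply: ler_pM => //; first exact: powR_ge0.
    by apply: sumr_ge0 => v _; rewrite mulr_ge0 ?link_prob_ge0.
  apply: ge0_ler_powR; rewrite ?nnegrE ?D0 ?(ltW al0) ?(ltW X0) //.
  exact: mean_dist_le.
apply: (@lt_le_trans _ _
    ((X / (A * B)) `^ alpha u * (X `^ (m - k%:R) / B ^+ 2))); last first.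
  apply: ler_pM => //; rewrite ?powR_ge0 ?divr_ge0 ?powR_ge0 ?exprn_ge0 ?(ltW B0) //.
  apply: ge0_ler_powR; rewrite ?nnegrE ?D0 ?(ltW al0) //.
    by rewrite divr_ge0 // ltW.
  apply: le_trans mean_ge.
  rewrite ler_wpM2l ?(ltW X0) // lef_pV2 ?posrE ?mulr_gt0 //.
    by rewrite ler_wpM2l ?(ltW A0).
  exact: lt_le_trans (N1 u).
have Y0 : 0 < X `^ alpha u * X `^ (m - k%:R) by rewrite mulr_gt0 ?powR_gt0.
have Za0 : 0 < (A * B) `^ alpha u by apply: powR_gt0.
have Xc0 : 0 < X `^ c by apply: powR_gt0.
have -> : (X / (A * B)) `^ alpha u = X `^ alpha u / (A * B) `^ alpha u.
  rewrite powRM ?invr_ge0 ?(ltW X0) ?(ltW Z0) //; congr (_ * _).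
  by rewrite -(powR_inv1 (ltW Z0)) -powRrM mulN1r powRN.
rewrite [ltLHS](_ : _ = X `^ alpha u * X `^ (m - k%:R) *
  (A ^+ 2 * B / X `^ c)); last by ring.
rewrite [ltRHS](_ : _ = X `^ alpha u * X `^ (m - k%:R) *
  ((A * B) `^ alpha u * B ^+ 2)^-1); last by rewrite (invfM (_ `^ alpha u)); ring.
rewrite ltr_pM2l // ltr_pdivrMr // ltr_pdivlMl ?mulr_gt0 ?exprn_gt0 //.
(* What remains is [(A B)^(alpha u) A^2 B^3 < X^c], and [A^2 B^3 <= (A B)^3]; hence the condition
   [3 + b <= E]. *)
apply: le_lt_trans ABX; rewrite -(powR_mulrn E (ltW Z0)).
apply: (@le_trans _ _ ((A * B) `^ (3 + alpha u))); last first.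
  by apply: ler_powR => //; lra.
rewrite powRD ?(gt_eqF Z0) ?implybT // (powR_mulrn 3 (ltW Z0)).
rewrite [leRHS](_ : _ = (A * B) `^ alpha u * B ^+ 2 * (A ^+ 2 * B) * A); last by ring.
by rewrite ler_peMr // !mulr_ge0 ?exprn_ge0 ?powR_ge0 ?(ltW A0) ?(ltW B0).
Qed.

(** * Choice of the threshold and the equilibrium argument *)

Lemma norm_const_dim_negligible (R : realType) (k E : nat) (c : R) :
  (1 <= k)%N -> 0 < c ->
  exists n0 : nat, forall n, (n0 <= n)%N -> exists B : R,
    (forall u : node k n, norm_const u k%:R <= B) /\
    (2 * k%:R ^+ k * B) ^+ E < (k * n)%:R `^ c.
Proof.
move=> k1 c0.
(* The constant absorbs all factors: [2 k^k (6 L)^k <= (12 k L)^k] with [L = 1 + ln n], because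
   [2 <= 2^k]. *)
have C0 : 0 <= 12 * k%:R :> R by rewrite mulr_ge0.
have [n0 hn0] := polylog_lt_powR R (12 * k%:R) c (k * E) C0 c0.
exists n0.+1 => n nn0; exists ((6 * (1 + ln n%:R)) ^+ k).
split=> [u|]; first exact: norm_const_dim_le.
have n1 : (0 < n)%N by apply: leq_trans nn0.
have L0 : 0 <= 1 + ln n%:R :> R by rewrite addr_ge0 // ln_ge0 // ler1n.
apply: (@le_lt_trans _ _ ((12 * k%:R * (1 + ln n%:R)) ^+ (k * E))).
  rewrite exprM lerXn2r ?nnegrE ?mulr_ge0 ?exprn_ge0 ?mulr_ge0 //.
  have -> : (12 * k%:R * (1 + ln n%:R)) ^+ k =
            2 ^+ k * (k%:R ^+ k * (6 * (1 + ln n%:R)) ^+ k) :> R.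
    by rewrite -!exprMn; congr (_ ^+ k); ring.
  rewrite -mulrA ler_wpM2r ?mulr_ge0 ?exprn_ge0 ?mulr_ge0 //.
  by rewrite -{1}[2]expr1 ler_weXn2l // ler1n.
apply: lt_le_trans (hn0 n (ltnW nn0)) _.
by apply: ge0_ler_powR; rewrite ?nnegrE ?(ltW c0) // ler_nat leq_pmull.
Qed.

(** The node set grows with [n], so [n0] depends on the exponents through common bounds [a] and [b],
    fixed before [n] and [alpha]. *)
Theorem theorem3p2 (R : realType) (k g : nat) (hk : (1 <= k)%N) (hg : (2 <= g)%N)
    (a b : R) (ha : 0 < a) :
  exists n0 : nat, forall n : nat, (2 <= n)%N -> (n0 <= n)%N ->
    forall alpha : node k n -> R, (forall u, a <= alpha u <= b) ->
    forall s : node k n -> R, non_uniform s ->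
    ~ Nash_equilibrium (g%:R^-1) alpha s.
Proof.
have g0 : 0 < g%:R :> R by rewrite ltr0n ltnW.
set c : R := g%:R^-1.
have c0 : 0 < c by rewrite invr_gt0.
have c1 : c <= 1 by rewrite invf_le1 // ler1n ltnW.
have gc : g%:R * c = 1 by rewrite divff // gt_eqF.
(* One power serves both payoff comparisons; the absolute value keeps each requirement below the
   sum. *)
pose E := (Num.truncn (2 + a^-1 + `|3 + b|)).+1.
have hE : 2 + a^-1 + `|3 + b| < E%:R by apply: truncnS_gt.
have E1 : 2 + a^-1 <= E%:R by have := normr_ge0 (3 + b); lra.
have E2 : 3 + b <= E%:R.
  have := ler_norm (3 + b); have : 0 < a^-1 by rewrite invr_gt0.
  lra.
have [n0 hn0] := norm_const_dim_negligible R k E c hk c0.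
exists n0 => n n2 nn0 alpha hal s [u1 [u2 nu]] ne.
have [B [NB BX]] := hn0 n nn0.
(* As [gamma = 1/g], [k] is itself a strategy, and every other strategy differs from it by at least
   [c]. *)
have kc : k%:R = (k * g)%:R * c by rewrite natrM -mulrA gc mulr1.
have strat_k : strategies c k%:R by exists (k * g)%N.
have sle u : s u <= k%:R.
  have [[m _ ms] best] := ne u.
  rewrite leNgt; apply/negP => ks.
  have := best _ strat_k; apply/negP; rewrite -ltNge.
  have /andP[aal _] := hal u.
  apply: (@payoff_lt_above _ _ _ E _ _ _ a c) => //; first exact: ltW.
    apply: le_lt_trans BX; rewrite lerXn2r ?nnegrE ?mulr_ge0 ?exprn_ge0 //.
    - by apply: le_trans (norm_const_ge1 R k n u k%:R hk n2).
    - by apply: le_trans (NB u); apply: le_trans (norm_const_ge1 R k n u k%:R hk n2).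
    - by rewrite ler_wpM2l // mulr_ge0 // exprn_ge0.
  move: ks; rewrite -ms kc ltr_pM2r // ltr_nat -{2}[c]mul1r -mulrDl natr1 => ks.
  by rewrite ler_wpM2r ?(ltW c0) // ler_nat.
have s0 u : 0 <= s u.
  by have [[m _ <-] _] := ne u; rewrite mulr_ge0 // ltW.
(* Used twice: with [m = s w] for the maximal strategy, then with [m = k] to spread [k] over the
   torus. *)
have step m u w : c <= m -> (forall v, s v <= m) -> s w = m -> dist u w = 1%N ->
    s u = k%:R.
  move=> cm sm sw uw; have mk : m <= k%:R by rewrite -sw.
  have [[q _ qs] best] := ne u.
  apply/eqP; rewrite eq_le sle /= leNgt; apply/negP => sk.
  have := best _ strat_k; apply/negP; rewrite -ltNge.
  have /andP[aal alb] := hal u.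
  apply: (@payoff_lt_below _ _ _ E _ _ _ w b c m _ B) => //.
  - exact: lt_le_trans aal.
  - by move=> v; rewrite s0 sm.
  move: sk; rewrite -qs kc ltr_pM2r // ltr_nat => sk.
  by rewrite lerBrDr -{2}[c]mul1r -mulrDl natr1 ler_wpM2r ?(ltW c0) // ler_nat.
pose w := [arg max_(v > u1) s v]%O.
have wmax v : s v <= s w by rewrite /w; case: arg_maxP => // i _; apply.
(* Non-uniformity excludes the all-zero profile, and a nonzero multiple of [c] is at least [c]. *)
have cw : c <= s w.
  have [v sv] : exists v, s v != 0.
    case: (eqVneq (s u1) 0) => [e1|]; last by exists u1.
    by exists u2; apply/eqP => e2; apply: nu; rewrite e1 e2.
  apply: le_trans (wmax v); have [[[|q] _ qs] _] := ne v.
    by move: sv; rewrite -qs mul0r eqxx.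
  by rewrite -qs -{1}[c]mul1r ler_wpM2r ?(ltW c0) // ler1n.
have [u uw] := exists_neighbor _ _ w hk n2.
have su : s u = k%:R by apply: step cw wmax erefl _; rewrite distC.
have ck : c <= k%:R by apply: le_trans (sle w).
have all_k v : s v = k%:R.
  apply: (torus_ind _ _ (fun v => s v = k%:R) u n2 su) => x y sx xy.
  by apply: step ck sle sx _; rewrite distC.
by apply: nu; rewrite !all_k.
Qed.
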